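(* A modified Patankar-Runge-Kutta (MPRK) scheme applied to a fully conservative production-destruction system is unconditionally positive, i.e. for all $\Delta t>0$ and all $\mathbf y^n>0$ one has $\mathbf y^{n+1}>0$. The same holds for all the stages of the scheme: for all $\Delta t>0$ and $\mathbf y^n>0$ one has $\mathbf y^{(k)}>0$ for $k=1,\dots,s$. (Inequalities between vectors are componentwise.)
   Context: A production-destruction system (PDS) is an ODE system $y_i'(t)=P_i(\mathbf y(t))-D_i(\mathbf y(t))$, $i=1,\dots,N$, with $P_i(\mathbf y)=\sum_{j=1}^N p_{ij}(\mathbf y)$, $D_i(\mathbf y)=\sum_{j=1}^N d_{ij}(\mathbf y)$, where $p_{ij}(\mathbf y),d_{ij}(\mathbf y)\ge0$. It is fully conservative if $p_{ij}(\mathbf y)=d_{ji}(\mathbf y)$ and $p_{ii}(\mathbf y)=d_{ii}(\mathbf y)=0$ for all $i,j$ and all $\mathbf y\ge0$. Given a non-negative Runge-Kutta matrix $(a_{k\nu})_{k,\nu=1,\dots,s}$, non-negative weights $b_1,\dots,b_s$ and $\delta\in\{0,1\}$, an MPRK scheme is the one-step scheme $\mathbf y^n\mapsto\mathbf y^{n+1}$ given for $i=1,\dots,N$ by $$y_i^{(k)}=y_i^n+\Delta t\sum_{\nu=1}^{k-1}a_{k\nu}\sum_{j=1}^N\Bigl(p_{ij}(\mathbf y^{(\nu)})(1-\delta)+p_{ij}(\mathbf y^{(\nu)})\frac{y_j^{(k)}}{\pi_j^{(k)}}\delta-d_{ij}(\mathbf y^{(\nu)})\frac{y_i^{(k)}}{\pi_i^{(k)}}\Bigr),\quad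 k=1,\dots,s,$$ $$y_i^{n+1}=y_i^n+\Delta t\sum_{k=1}^s b_k\sum_{j=1}^N\Bigl(p_{ij}(\mathbf y^{(k)})\frac{y_j^{n+1}}{\sigma_j}-d_{ij}(\mathbf y^{(k)})\frac{y_i^{n+1}}{\sigma_i}\Bigr),$$ where the Patankar-weight denominators $\pi_i^{(k)}$ and $\sigma_i$ are positive for all $\Delta t>0$ and $\mathbf y^n>0$, $\pi_i^{(k)}$ is independent of $y_i^{(k)}$, and $\sigma_i$ is independent of $y_i^{n+1}$ (they may depend on $\Delta t$, $\mathbf y^n$ and previously computed stage values), so that each $\mathbf y^{(k)}$ and $\mathbf y^{n+1}$ is the solution of a linear system. *)

(* Defs.v *)
From mathcomp Require Import all_boot all_order all_algebra.
From mathcomp Require Import reals.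

Set Implicit Arguments.
Unset Strict Implicit.
Unset Printing Implicit Defensive.

Import Order.TTheory GRing.Theory Num.Theory.
Local Open Scope ring_scope.

Section MPRK.
Variables (R : realType) (N s : nat).

Definition vec_ge0 (y : 'cV[R]_N) : Prop := forall i, 0 <= y i 0.
Definition vec_gt0 (y : 'cV[R]_N) : Prop := forall i, 0 < y i 0.

(* The data of the system y_i' = \sum_j (p i j y - d i j y). *)
Record pds := Pds {
  pds_p : 'I_N -> 'I_N -> 'cV[R]_N -> R;
  pds_d : 'I_N -> 'I_N -> 'cV[R]_N -> R;
  pds_p_ge0 : forall i j y, vec_ge0 y -> 0 <= pds_p i j y;
  pds_d_ge0 : forall i j y, vec_ge0 y -> 0 <= pds_d i j y
}.

Definition fully_conservative (S : pds) : Prop :=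
  forall y, vec_ge0 y ->
    (forall i j, pds_p S i j y = pds_d S j i y) /\
    (forall i, pds_p S i i y = 0 /\ pds_d S i i y = 0).

(* The Patankar-weight denominators are functions of dt, y^n and the family of
   stages; mprk_pi_prev says that those of stage k only see the stages before
   k.  Since mprk_sigma is not given y^{n+1}, no such condition is needed for
   it.  delta in {0, 1} is a boolean. *)
Record mprk := Mprk {
  mprk_a : 'M[R]_s;
  mprk_b : 'I_s -> R;
  mprk_delta : bool;
  mprk_pi : 'I_s -> R -> 'cV[R]_N -> {ffun 'I_s -> 'cV[R]_N} -> 'cV[R]_N;
  mprk_sigma : R -> 'cV[R]_N -> {ffun 'I_s -> 'cV[R]_N} -> 'cV[R]_N;
  mprk_a_ge0 : forall k nu, 0 <= mprk_a k nu;
  mprk_b_ge0 : forall k, 0 <= mprk_b k;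
  mprk_pi_prev : forall (k : 'I_s) dt yn (Y Y' : {ffun 'I_s -> 'cV[R]_N}),
    (forall nu : 'I_s, (nu < k)%N -> Y nu = Y' nu) ->
    mprk_pi k dt yn Y = mprk_pi k dt yn Y'
}.

Variables (M : mprk) (S : pds).

Definition mprk_stage_eq (dt : R) (yn : 'cV[R]_N)
    (Y : {ffun 'I_s -> 'cV[R]_N}) (k : 'I_s) : Prop :=
  let p := pds_p S in let d := pds_d S in
  let delta : R := (mprk_delta M)%:R in
  let pi := mprk_pi M k dt yn Y in
  forall i, Y k i 0 = yn i 0 + dt *
    \sum_(nu < s | (nu < k)%N) mprk_a M k nu *
      \sum_(j < N) (p i j (Y nu) * (1 - delta)
                    + p i j (Y nu) * (Y k j 0 / pi j 0) * delta
                    - d i j (Y nu) * (Y k i 0 / pi i 0)).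

Definition mprk_update_eq (dt : R) (yn : 'cV[R]_N)
    (Y : {ffun 'I_s -> 'cV[R]_N}) (y1 : 'cV[R]_N) : Prop :=
  let p := pds_p S in let d := pds_d S in
  let sigma := mprk_sigma M dt yn Y in
  forall i, y1 i 0 = yn i 0 + dt *
    \sum_(k < s) mprk_b M k *
      \sum_(j < N) (p i j (Y k) * (y1 j 0 / sigma j 0)
                    - d i j (Y k) * (y1 i 0 / sigma i 0)).

Definition mprk_step (dt : R) (yn : 'cV[R]_N)
    (Y : {ffun 'I_s -> 'cV[R]_N}) (y1 : 'cV[R]_N) : Prop :=
  (forall k, mprk_stage_eq dt yn Y k) /\ mprk_update_eq dt yn Y y1.

(* Denominators are only required to be positive at the stage values which the
   scheme actually computes from dt and y^n; typical denominators, such as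
   products of powers of stages, are not positive at arbitrary arguments. *)
Definition mprk_weights_gt0 : Prop :=
  forall dt yn, 0 < dt -> vec_gt0 yn ->
  forall Y : {ffun 'I_s -> 'cV[R]_N},
    (forall k : 'I_s,
       (forall nu : 'I_s, (nu < k)%N -> mprk_stage_eq dt yn Y nu) ->
       vec_gt0 (mprk_pi M k dt yn Y)) /\
    ((forall k, mprk_stage_eq dt yn Y k) -> vec_gt0 (mprk_sigma M dt yn Y)).

(* The scheme is a map: its equations determine the stages and y^{n+1}. *)
Definition mprk_well_defined : Prop :=
  forall dt yn, 0 < dt -> vec_gt0 yn ->
  exists! z : {ffun 'I_s -> 'cV[R]_N} * 'cV[R]_N, mprk_step dt yn z.1 z.2.

Definition unconditionally_positive : Prop :=
  forall dt yn, 0 < dt -> vec_gt0 yn ->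
  forall Y y1, mprk_step dt yn Y y1 -> vec_gt0 y1.

Definition stages_unconditionally_positive : Prop :=
  forall dt yn, 0 < dt -> vec_gt0 yn ->
  forall Y : {ffun 'I_s -> 'cV[R]_N},
    (forall k, mprk_stage_eq dt yn Y k) -> forall k, vec_gt0 (Y k).

End MPRK.

(* Main.v *)
Require Import Defs.
From mathcomp Require Import all_boot all_order all_algebra.
From mathcomp Require Import reals ring lra.

(** Given the earlier stages, every stage and the final update solve one and
    the same kind of linear system.  Collecting the terms in the unknown [x]
    and using [d i j = p j i], it reads
      [(1 + L i) * x i = r i + \sum_j H i j * x j],
    where [H >= 0], [r > 0] and [L j] is the total outflow rate of constituent
    [j].  Conservation says that what leaves [j] arrives somewhere, so column
    [j] of [H] sums to [L j] or, when the production terms carry no Patankar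
    weight, to [0]; in both cases to less than [1 + L j].  The matrix
    [diag (1 + L) - H] is therefore strictly diagonally dominant by columns with
    nonpositive off-diagonal entries (an M-matrix).  Such a matrix is invertible
    with nonnegative inverse ([col_dominant_solution_ge0],
    [col_dominant_system_solvable]).  The nonnegative solution then satisfies
    [(1 + L i) * x i >= r i > 0], so it is positive
    ([col_dominant_solution_gt0]).  This holds whatever the size of the time
    step, which is only a factor in [L] and [H].

    [patankar_system] transfers this to the Patankar equations.  The theorem
    follows by induction on the stages: once the stages before [k] are known to
    be positive, the production terms evaluated there are nonnegative and
    conservative, the denominators of stage [k] are positive, and the
    linear result gives existence, uniqueness and positivity of stage [k]. *)

Set Implicit Arguments.
Unset Strict Implicit.
Unset Printing Implicit Defensive.

Import Order.TTheory GRing.Theory Num.Theory.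
Local Open Scope ring_scope.

(** * Column-dominant linear systems *)

Section ColumnDominant.
Variables (F : realFieldType) (n : nat) (c : 'I_n -> F) (H : 'I_n -> 'I_n -> F).
Hypothesis H_ge0 : forall i j, 0 <= H i j.
Hypothesis H_dominated : forall j, \sum_i H i j < c j.

Let c_gt0 j : 0 < c j.
Proof. by apply: le_lt_trans (H_dominated j); apply: sumr_ge0. Qed.

(** The negative part [m] of [x] satisfies [c i * m i <= \sum_j H i j * m j].
    Summing over [i] gives [\sum_j (c j - \sum_i H i j) * m j <= 0], a sum of
    nonnegative terms with positive coefficients, so [m] vanishes. *)
Lemma col_dominant_solution_ge0 (r x : 'I_n -> F) :
  (forall i, 0 <= r i) ->
  (forall i, c i * x i = r i + \sum_j H i j * x j) ->
  forall i, 0 <= x i.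
Proof.
move=> r_ge0 xE.
pose m i : F := Num.max (- x i) 0.
have m_ge0 i : 0 <= m i by rewrite le_max lexx orbT.
have Nx_le_m i : - x i <= m i by rewrite le_max lexx.
have cm_le i : c i * m i <= \sum_j H i j * m j.
  have Hm_ge0 : 0 <= \sum_j H i j * m j.
    by apply: sumr_ge0 => j _; rewrite mulr_ge0.
  rewrite {1}/m; case: (lerP (- x i) 0) => _; first by rewrite mulr0.
  rewrite mulrN xE opprD -sumrN.
  apply: (@le_trans _ _ (\sum_j - (H i j * x j))).
    by rewrite gerDr oppr_le0.
  by apply: ler_sum => j _; rewrite -mulrN ler_wpM2l.
have gap_ge0 j : 0 <= (c j - \sum_i H i j) * m j.
  by rewrite mulr_ge0 // subr_ge0 ltW.
have gap_sum0 : \sum_j (c j - \sum_i H i j) * m j = 0.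
  apply/eqP; rewrite eq_le sumr_ge0 // andbT.
  under eq_bigr do rewrite mulrBl mulr_suml.
  by rewrite sumrB exchange_big subr_le0; apply: ler_sum.
move=> i.
have /eqP := psumr_eq0P (fun j _ => gap_ge0 j) gap_sum0 (i := i) isT.
rewrite mulf_eq0 subr_eq0 gt_eqF //= => /eqP m0.
by have := Nx_le_m i; rewrite m0 oppr_le0.
Qed.

Lemma col_dominant_solution_gt0 (r x : 'I_n -> F) :
  (forall i, 0 < r i) ->
  (forall i, c i * x i = r i + \sum_j H i j * x j) ->
  forall i, 0 < x i.
Proof.
move=> r_gt0 xE i; rewrite -(pmulr_rgt0 _ (c_gt0 i)) xE ltr_wpDr //.
apply: sumr_ge0 => j _; rewrite mulr_ge0 //.
by apply: col_dominant_solution_ge0 xE _ => k; apply: ltW.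
Qed.

(** Nonnegativity applied to [x] and [- x] shows that the homogeneous system
    has only the zero solution, so the square matrix is invertible. *)
Lemma col_dominant_system_solvable (r : 'I_n -> F) :
  exists! x : 'cV[F]_n, forall i, c i * x i 0 = r i + \sum_j H i j * x j 0.
Proof.
pose A : 'M[F]_n := \matrix_(i, j) (c i *+ (i == j) - H i j).
have AE (x : 'cV[F]_n) i : (A *m x) i 0 = c i * x i 0 - \sum_j H i j * x j 0.
  rewrite mxE; under eq_bigr do rewrite mxE mulrBl.
  rewrite sumrB; congr (_ - _).
  rewrite (bigD1 i) //= eqxx mulr1n big1 ?addr0 // => j j_neq_i.
  by rewrite eq_sym (negbTE j_neq_i) mulr0n mul0r.
have A_inj (x : 'cV[F]_n) : A *m x = 0 -> x = 0.
  move=> Ax0; have xE i : c i * x i 0 = 0 + \sum_j H i j * x j 0.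
    by rewrite add0r; apply/eqP; rewrite -subr_eq0 -AE Ax0 mxE.
  have NxE i : c i * - x i 0 = 0 + \sum_j H i j * - x j 0.
    by rewrite mulrN xE opprD oppr0 -sumrN; under eq_bigr do rewrite -mulrN.
  have z_ge0 (i : 'I_n) : 0 <= (fun=> 0 : F) i by [].
  apply/colP => i; rewrite [RHS]mxE; apply/eqP; rewrite eq_le -oppr_ge0.
  by rewrite (col_dominant_solution_ge0 z_ge0 NxE)
             (col_dominant_solution_ge0 z_ge0 xE).
have A_unit : A \in unitmx.
  rewrite -unitmx_tr -row_free_unit -kermx_eq0; apply/eqP/row_matrixP => i.
  have /(congr1 trmx) : row i (kermx A^T) *m A^T = 0.
    by rewrite -row_mul mulmx_ker row0.
  rewrite trmx_mul trmxK trmx0 => /A_inj /(congr1 trmx).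
  by rewrite trmxK trmx0 row0.
have systemP (x : 'cV[F]_n) :
    (forall i, c i * x i 0 = r i + \sum_j H i j * x j 0) <->
    A *m x = \col_i r i.
  split=> [xE|Ax i]; first by apply/colP => i; rewrite AE xE addrK mxE.
  by have := AE x i; rewrite Ax mxE => ->; rewrite subrK.
exists (invmx A *m \col_i r i); split.
  by apply/systemP; rewrite mulKVmx.
by move=> x /systemP <-; rewrite mulKmx.
Qed.

End ColumnDominant.

(** * Patankar systems *)

Section PatankarSystem.
Variables (R : realFieldType) (N : nat) (I : finType) (P : pred I).

(** The common form of the equations of a stage and of the update: [nu] ranges
    over the stages at which the production and destruction terms have been
    evaluated, [w] is the vector of denominators and [x] the unknown. *)
Definition patankar_eq (dt theta : R) (a : I -> R) (p d : I -> 'I_N -> 'I_N -> R)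
    (w y x : 'cV[R]_N) : Prop :=
  forall i, x i 0 = y i 0 + dt * \sum_(nu | P nu) a nu *
    \sum_j (p nu i j * (1 - theta) + p nu i j * (x j 0 / w j 0) * theta
            - d nu i j * (x i 0 / w i 0)).

Variables (dt theta : R) (a : I -> R) (p d : I -> 'I_N -> 'I_N -> R).
Variables (w y : 'cV[R]_N).
Hypotheses (dt_ge0 : 0 <= dt) (theta_01 : 0 <= theta <= 1).
Hypothesis a_ge0 : forall nu, 0 <= a nu.
Hypothesis p_ge0 : forall nu, P nu -> forall i j, 0 <= p nu i j.
Hypothesis conservative : forall nu, P nu -> forall i j, p nu i j = d nu j i.
Hypotheses (w_gt0 : forall i, 0 < w i 0) (y_gt0 : forall i, 0 < y i 0).

Let flux i j := dt * \sum_(nu | P nu) a nu * p nu i j.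
Let c i := 1 + (\sum_j flux j i) / w i 0.
Let H i j := theta * flux i j / w j 0.
Let r i := y i 0 + (1 - theta) * \sum_j flux i j.

Let flux_ge0 i j : 0 <= flux i j.
Proof.
by rewrite mulr_ge0 // sumr_ge0 // => nu Pnu; rewrite mulr_ge0 // p_ge0.
Qed.

(** Conservation turns the destruction terms of constituent [i] into column
    [i] of the flux matrix. *)
Let patankar_eqE x :
  patankar_eq dt theta a p d w y x <->
  forall i, c i * x i 0 = r i + \sum_j H i j * x j 0.
Proof.
have rhsE i : dt * \sum_(nu | P nu) a nu *
    \sum_j (p nu i j * (1 - theta) + p nu i j * (x j 0 / w j 0) * theta
            - d nu i j * (x i 0 / w i 0))
  = (1 - theta) * (\sum_j flux i j) + \sum_j H i j * x j 0
    - (\sum_j flux j i) / w i 0 * x i 0.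
  rewrite mulr_sumr (eq_bigr (fun nu => \sum_j dt * (a nu *
     (p nu i j * (1 - theta) + p nu i j * (x j 0 / w j 0) * theta
            - p nu j i * (x i 0 / w i 0))))); last first.
    move=> nu Pnu; rewrite !mulr_sumr; apply: eq_bigr => j _.
    by rewrite (conservative Pnu j i).
  rewrite exchange_big mulr_sumr !mulr_suml -big_split -sumrB /=.
  apply: eq_bigr => j _; rewrite /H /flux.
  rewrite !mulr_sumr !mulr_suml -big_split -sumrB /=.
  by apply: eq_bigr => nu _; ring.
split=> xE i; by have := xE i; rewrite rhsE /c /r => xiE; lra.
Qed.

Lemma patankar_system :
  (exists! x, patankar_eq dt theta a p d w y x) /\
  (forall x, patankar_eq dt theta a p d w y x -> forall i, 0 < x i 0).
Proof.
have [theta_ge0 theta_le1] := andP theta_01.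
have H_ge0 i j : 0 <= H i j.
  by rewrite mulr_ge0 ?invr_ge0 ?(ltW (w_gt0 j)) // mulr_ge0.
have H_dominated j : \sum_i H i j < c j.
  rewrite -mulr_suml -mulr_sumr ltr_pwDl // ler_wpM2r //.
    by rewrite invr_ge0 ltW.
  by rewrite ler_piMl // sumr_ge0.
have r_gt0 i : 0 < r i.
  by rewrite ltr_wpDr // mulr_ge0 ?subr_ge0 // sumr_ge0.
split.
  have [x [xE x_uniq]] := col_dominant_system_solvable H_ge0 H_dominated r.
  exists x; split; first exact/patankar_eqE.
  by move=> x' /patankar_eqE /x_uniq.
move=> x /patankar_eqE xE.
exact: (col_dominant_solution_gt0 H_ge0 H_dominated r_gt0 (x := fun i => x i 0)).
Qed.

End PatankarSystem.

(** * The stages and the update of an MPRK step *)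

Section MPRKStep.
Variables (R : realType) (N s : nat) (S : pds R N) (M : mprk R N s).
Hypotheses (S_cons : fully_conservative S) (M_gt0 : mprk_weights_gt0 M S).
Variables (dt : R) (yn : 'cV[R]_N).
Hypotheses (dt_gt0 : 0 < dt) (yn_gt0 : vec_gt0 yn).

Implicit Types (Y : {ffun 'I_s -> 'cV[R]_N}) (x : 'cV[R]_N) (k nu : 'I_s).

(** Separating the value [x] of stage [k] from the family [Y] exhibits the
    equation as a linear one in [x], with coefficients given by the stages
    before [k]. *)
Definition stage_system Y k x : Prop :=
  patankar_eq (fun nu => nu < k)%N dt (mprk_delta M)%:R (mprk_a M k)
    (fun nu i j => pds_p S i j (Y nu)) (fun nu i j => pds_d S i j (Y nu))
    (mprk_pi M k dt yn Y) yn x.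

Lemma stage_eq_system Y k : mprk_stage_eq M S dt yn Y k <-> stage_system Y k (Y k).
Proof. by []. Qed.

Lemma eq_stage_system Y Y' k x :
  (forall nu, (nu < k)%N -> Y nu = Y' nu) ->
  stage_system Y k x -> stage_system Y' k x.
Proof.
move=> eqY xE i; rewrite {1}(xE i) (mprk_pi_prev M dt yn eqY).
by congr (_ + _ * _); apply: eq_bigr => nu nu_lt_k; rewrite eqY.
Qed.

Lemma stage_system_solution Y k :
  (forall nu, (nu < k)%N -> mprk_stage_eq M S dt yn Y nu /\ vec_gt0 (Y nu)) ->
  (exists! x, stage_system Y k x) /\ (forall x, stage_system Y k x -> vec_gt0 x).
Proof.
move=> prevY; have Y_ge0 nu : (nu < k)%N -> vec_ge0 (Y nu).
  by move=> /prevY[_ Y_gt0] i; apply: ltW.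
apply: patankar_system => //.
- exact: ltW.
- by case: mprk_delta; rewrite /= ?lexx ler01.
- exact: mprk_a_ge0.
- by move=> nu /Y_ge0 Ynu i j; apply: pds_p_ge0.
- by move=> nu /Y_ge0 /S_cons[pE _] i j; apply: pE.
- by apply: (M_gt0 dt_gt0 yn_gt0 Y).1 => nu /prevY[].
Qed.

Lemma stages_gt0 Y : (forall k, mprk_stage_eq M S dt yn Y k) ->
  forall k, vec_gt0 (Y k).
Proof.
move=> YE k; have [m] := ubnP (val k); elim: m k => // m IHm k k_lt.
apply: (stage_system_solution (k := k) _).2 (YE k) => nu nu_lt_k.
by split=> //; apply: IHm; apply: leq_trans nu_lt_k _.
Qed.

Lemma stages_unique Y Y' :
  (forall k, mprk_stage_eq M S dt yn Y k) ->
  (forall k, mprk_stage_eq M S dt yn Y' k) -> Y = Y'.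
Proof.
move=> YE Y'E; apply/ffunP => k.
have [m] := ubnP (val k); elim: m k => // m IHm k k_lt.
have eqY nu : (nu < k)%N -> Y' nu = Y nu.
  by move=> nu_lt_k; rewrite IHm // (leq_trans nu_lt_k).
have [[x [_ x_uniq]] _] :=
  stage_system_solution (k := k) (fun nu _ => conj (YE nu) (stages_gt0 YE nu)).
by rewrite -(x_uniq _ (YE k)) (x_uniq _ (eq_stage_system eqY (Y'E k))).
Qed.

(** Stages are computed one after the other: replacing stage [m] of a family
    that is correct before [m] leaves the earlier equations untouched, because
    these do not see stage [m]. *)
Lemma stages_exist : exists Y, forall k, mprk_stage_eq M S dt yn Y k.
Proof.
suff /(_ s) [Y YE] : forall m, exists Y, forall k, (k < m)%N ->
    mprk_stage_eq M S dt yn Y k /\ vec_gt0 (Y k).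
  by exists Y => k; have [] := YE k (ltn_ord k).
elim=> [|m [Y YE]]; first by exists [ffun=> 0].
have [m_lt_s|s_le_m] := ltnP m s; last first.
  by exists Y => k _; apply: YE; apply: leq_trans (ltn_ord k) s_le_m.
pose km := Ordinal m_lt_s.
have [[x [xE _]] sol_gt0] := stage_system_solution (k := km) YE.
pose Y' : {ffun 'I_s -> 'cV[R]_N} := [ffun k => if k == km then x else Y k].
have Y'km : Y' km = x by rewrite ffunE eqxx.
have Y'lt nu : (nu < m)%N -> Y nu = Y' nu.
  move=> nu_lt_m; rewrite ffunE ifN //.
  by apply: contraTneq nu_lt_m => ->; rewrite ltnn.
exists Y' => k; rewrite ltnS leq_eqVlt => /orP[/eqP km_eq|k_lt_m].
  have -> : k = km by apply: val_inj.
  rewrite Y'km; split; last exact: sol_gt0.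
  by apply/stage_eq_system; rewrite Y'km; apply: eq_stage_system xE.
have [Yk Yk_gt0] := YE k k_lt_m; rewrite -Y'lt //; split=> //.
apply/stage_eq_system; rewrite -Y'lt //; apply: eq_stage_system Yk => nu nu_lt_k.
by apply: Y'lt; apply: ltn_trans nu_lt_k _.
Qed.

(** The update is a Patankar system with fully weighted production terms. *)
Lemma update_eq_system Y x : mprk_update_eq M S dt yn Y x <->
  patankar_eq xpredT dt 1 (mprk_b M)
    (fun nu i j => pds_p S i j (Y nu)) (fun nu i j => pds_d S i j (Y nu))
    (mprk_sigma M dt yn Y) yn x.
Proof.
split=> [xE i|xE p d sigma i]; rewrite {1}(xE i);
  congr (_ + _ * _); apply: eq_bigr => nu _;
  by congr (_ * _); apply: eq_bigr => j _; rewrite subrr mulr0 add0r mulr1.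
Qed.

Lemma update_solution Y : (forall k, mprk_stage_eq M S dt yn Y k) ->
  (exists! x, mprk_update_eq M S dt yn Y x) /\
  (forall x, mprk_update_eq M S dt yn Y x -> vec_gt0 x).
Proof.
move=> YE; have Y_ge0 k : vec_ge0 (Y k).
  by move=> i; apply: ltW; apply: stages_gt0.
have [] := @patankar_system R N 'I_s xpredT dt 1 (mprk_b M)
  (fun nu i j => pds_p S i j (Y nu)) (fun nu i j => pds_d S i j (Y nu))
  (mprk_sigma M dt yn Y) yn.
- exact: ltW.
- by rewrite ler01 lexx.
- exact: mprk_b_ge0.
- by move=> nu _ i j; apply: pds_p_ge0.
- by move=> nu _ i j; apply: (S_cons (Y_ge0 nu)).1.
- exact: (M_gt0 dt_gt0 yn_gt0 Y).2.
- exact: yn_gt0.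
move=> [x [xE x_uniq]] sol_gt0; split.
  exists x; split; first exact/update_eq_system.
  by move=> x' /update_eq_system /x_uniq.
by move=> x' /update_eq_system /sol_gt0.
Qed.

End MPRKStep.

Theorem lemma2p7 (R : realType) (N s : nat) (S : pds R N) (M : mprk R N s) :
  fully_conservative S -> mprk_weights_gt0 M S ->
  mprk_well_defined M S /\
  unconditionally_positive M S /\
  stages_unconditionally_positive M S.
Proof.
move=> S_cons M_gt0; split; last split.
- move=> dt yn dt_gt0 yn_gt0.
  have [Y YE] := stages_exist S_cons M_gt0 dt_gt0 yn_gt0.
  have [[y1 [y1E y1_uniq]] _] := update_solution S_cons M_gt0 dt_gt0 yn_gt0 YE.
  exists (Y, y1); split=> // -[Y' y1'] [/= Y'E].
  rewrite -(stages_unique S_cons M_gt0 dt_gt0 yn_gt0 YE Y'E).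
  by move=> /y1_uniq ->.
- move=> dt yn dt_gt0 yn_gt0 Y y1 [YE].
  exact: (update_solution S_cons M_gt0 dt_gt0 yn_gt0 YE).2.
- by move=> dt yn dt_gt0 yn_gt0 Y; apply: stages_gt0.
Qed.
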